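(* Let $h>0$, $a,b\in h\mathbb{Z}$ with $a<b$, $\mathbb{T}=[a,b]\cap h\mathbb{Z}$, and $\alpha,\beta\in(0,1]$. Let $L(t,u,v,w):\mathbb{T}^\kappa\times\mathbb{R}^3\to\mathbb{R}$ be such that the second-order partial derivatives $L_{uu},L_{uv},L_{uw},L_{vw},L_{vv},L_{ww}$ exist and are continuous, and let $A,B\in\mathbb{R}$. If $\hat y\in\mathcal{F}_{\mathbb{T}}$ is a local minimum for the problem $$\mathcal{L}[y(\cdot)]=\int_{a}^{b}L\bigl(t,y^{\sigma}(t),{_a}\Delta_h^\alpha y(t),{_h}\Delta_b^\beta y(t)\bigr)\Delta t\longrightarrow\min,\quad y(a)=A,\ y(b)=B,$$ then $$L_u[\hat y](t)+{_h}\Delta_{\rho(b)}^\alpha L_v[\hat y](t)+{_a}\Delta_h^\beta L_w[\hat y](t)=0$$ holds for all $t\in\mathbb{T}^{\kappa^2}$, where $[y](s)=(s,y^\sigma(s),{_a}\Delta_h^\alpha y(s),{_h}\Delta_b^\beta y(s))$.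
   Context: $\sigma(t)=t+h$, $\rho(t)=t-h$, $f^\sigma(t)=f(\sigma(t))$, $f^\Delta(t)=(f(t+h)-f(t))/h$, $\int_c^d f(t)\Delta t=\sum_{k=c/h}^{d/h-1}f(kh)h$. $\mathbb{T}^\kappa=[a,b-h]\cap h\mathbb{Z}$, $\mathbb{T}^{\kappa^2}=[a,b-2h]\cap h\mathbb{Z}$. $\mathcal{F}_{\mathbb{T}}$ is the set of real functions on $\mathbb{T}$. The $h$-factorial is $x_h^{(y)}=h^y\Gamma(\frac{x}{h}+1)/\Gamma(\frac{x}{h}+1-y)$ (division at a pole yields zero). For $\nu>0$ and $c,d\in h\mathbb{Z}$, the left and right fractional $h$-sums, evaluated at shifted points, are $${_c}\Delta_h^{-\nu}f(t+\nu h)=\frac{1}{\Gamma(\nu)}\sum_{k=c/h}^{t/h}(t+\nu h-\sigma(kh))_h^{(\nu-1)}f(kh)h,$$ $${_h}\Delta_d^{-\nu}f(t-\nu h)=\frac{1}{\Gamma(\nu)}\sum_{k=t/h}^{d/h}(kh+\nu h-\sigma(t))_h^{(\nu-1)}f(kh)h,$$ and for $\nu=0$ both are $f(t)$. For $0<\alpha\le1$ and $\gamma=1-\alpha$, the left and right fractional differences are $${_c}\Delta_h^{\alpha}f(t)=\bigl({_c}\Delta_h^{-\gamma}f(t+\gamma h)\bigr)^\Delta,\qquad {_h}\Delta_d^{\alpha}f(t)=-\bigl({_h}\Delta_d^{-\gamma}f(t-\gamma h)\bigr)^\Delta ,$$ where $\Delta$ acts on the variable $t$. (For order $\beta$ replace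 $\gamma$ by $1-\beta$.) $L_u,L_v,L_w$ are partial derivatives with respect to the second, third, fourth arguments, and $L_v[\hat y]$ is the function $t\mapsto L_v([\hat y](t))$ on $\mathbb{T}^\kappa$ (similarly $L_u[\hat y],L_w[\hat y]$). A function $\hat y\in\mathcal{F}_{\mathbb{T}}$ with $\hat y(a)=A,\hat y(b)=B$ is a local minimum if there is $\delta>0$ with $\mathcal{L}[\hat y]\le\mathcal{L}[y]$ for all $y\in\mathcal{F}_{\mathbb{T}}$ with $y(a)=A$, $y(b)=B$, $\|y-\hat y\|<\delta$, where $\|f\|=\max_{\mathbb{T}^\kappa}|f^\sigma|+\max_{\mathbb{T}^\kappa}|{_a}\Delta_h^\alpha f|+\max_{\mathbb{T}^\kappa}|{_h}\Delta_b^\beta f|$. *)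

(* Defs.v *)
From HB Require Import structures.
From mathcomp Require Import all_boot all_order all_algebra.
From mathcomp Require Import all_classical all_reals all_analysis.
Set Implicit Arguments.
Unset Strict Implicit.
Unset Printing Implicit Defensive.
Import Order.TTheory GRing.Theory Num.Theory.
Import numFieldNormedType.Exports.
Local Open Scope classical_set_scope.
Local Open Scope ring_scope.

(* A function on a finite set of points of h Z is
   represented by a function R -> R of which only the values at those points
   are ever used. *)

Section TimeScale.
Context {R : realType}.
Implicit Types (h a b c d t : R) (f : R -> R).

Definition hZ h : set R := [set t | exists k : int, t = k%:~R * h].

Definition hinterval h a b : set R := [set t | a <= t <= b] `&` hZ h.

Definition hsigma h t : R := t + h.
Definition hrho h t : R := t - h.
Definition hdelta h f t : R := (f (t + h) - f t) / h.

Definition zsum (p q : R) (F : int -> R) : R :=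
  \sum_(k \in [set k : int | p <= k%:~R <= q]) F k.

Definition hintegral h c d f : R :=
  zsum (c / h) (d / h - 1) (fun k => f (k%:~R * h) * h).

End TimeScale.

Section Gamma.
Context {R : realType}.
Implicit Types x y : R.

(* Euler's integral, meant for 0 < x *)
Definition Gamma_pos x : R :=
  (\int[lebesgue_measure]_(t in `]0, +oo[) (t `^ (x - 1) * expR (- t)))%R.

(* For x <= 0, Gamma x = Gamma (x + n) / (x (x+1) ... (x+n-1)) with n large
   enough for x + n to be positive.  At the poles 0, -1, -2, ... the product
   vanishes; since 0^-1 = 0, both Gamma and its inverse are then 0, which is the
   convention that division at a pole yields zero. *)
Definition Gamma x : R :=
  if 0 < x then Gamma_pos x
  else let n := (Num.truncn (- x)).+1 in
       Gamma_pos (x + n%:R) / \prod_(i < n) (x + i%:R).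

Definition hfactorial (h x y : R) : R :=
  h `^ y * (Gamma (x / h + 1) / Gamma (x / h + 1 - y)).

End Gamma.

Section FractionalOperators.
Context {R : realType}.
Implicit Types (h c d nu alpha t : R) (f : R -> R).

(* t |-> (left fractional h-sum of order nu of f)(t + nu h): the shift of the
   argument is built in; in right_hsum below it is t - nu h. *)
Definition left_hsum h c nu f t : R :=
  if nu == 0 then f t else
  (Gamma nu)^-1 *
  zsum (c / h) (t / h) (fun k =>
    hfactorial h (t + nu * h - hsigma h (k%:~R * h)) (nu - 1)
    * f (k%:~R * h) * h).

Definition right_hsum h d nu f t : R :=
  if nu == 0 then f t else
  (Gamma nu)^-1 *
  zsum (t / h) (d / h) (fun k =>
    hfactorial h (k%:~R * h + nu * h - hsigma h t) (nu - 1)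
    * f (k%:~R * h) * h).

Definition left_hdiff h c alpha f t : R :=
  hdelta h (left_hsum h c (1 - alpha) f) t.

Definition right_hdiff h d alpha f t : R :=
  - hdelta h (right_hsum h d (1 - alpha) f) t.

End FractionalOperators.

Section PartialDerivatives.
Context {R : realType}.
Implicit Types (L : R -> R -> R -> R -> R) (t : R).

Definition Du L : R -> R -> R -> R -> R :=
  fun t u v w => derive1 (fun x => L t x v w) u.
Definition Dv L : R -> R -> R -> R -> R :=
  fun t u v w => derive1 (fun x => L t u x w) v.
Definition Dw L : R -> R -> R -> R -> R :=
  fun t u v w => derive1 (fun x => L t u v x) w.

Definition ex_Du L t : Prop :=
  forall u v w, derivable (fun x => L t x v w) u 1.
Definition ex_Dv L t : Prop :=
  forall u v w, derivable (fun x => L t u x w) v 1.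
Definition ex_Dw L t : Prop :=
  forall u v w, derivable (fun x => L t u v x) w 1.

Definition continuous_uvw L t : Prop :=
  continuous (fun p : R * R * R => L t p.1.1 p.1.2 p.2).

(* Existence and continuity of L_uu, L_uv, L_uw, L_vw, L_vv, L_ww at a fixed t,
   with L_xy the y-derivative of L_x.  As the first argument ranges over a
   finite set of isolated points, continuity is only a condition on (u,v,w). *)
Definition C2_uvw L t : Prop :=
  [/\ ex_Du L t, ex_Dv L t & ex_Dw L t] /\
  [/\ ex_Du (Du L) t /\ continuous_uvw (Du (Du L)) t,
      ex_Dv (Du L) t /\ continuous_uvw (Dv (Du L)) t &
      ex_Dw (Du L) t /\ continuous_uvw (Dw (Du L)) t] /\
  [/\ ex_Dw (Dv L) t /\ continuous_uvw (Dw (Dv L)) t,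
      ex_Dv (Dv L) t /\ continuous_uvw (Dv (Dv L)) t &
      ex_Dw (Dw L) t /\ continuous_uvw (Dw (Dw L)) t].

End PartialDerivatives.

Section VariationalProblem.
Context {R : realType}.
Variables (h a b alpha beta : R).
Implicit Types (L F : R -> R -> R -> R -> R) (y f : R -> R).

Definition along F y : R -> R := fun s =>
  F s (y (hsigma h s)) (left_hdiff h a alpha y s) (right_hdiff h b beta y s).

Definition functional L y : R := hintegral h a b (along L y).

(* maximum over [a, b-h] in h Z: the set of values is finite and nonempty, so
   that its supremum is its maximum *)
Definition max_kappa f : R := sup (f @` hinterval h a (b - h)).

Definition var_norm f : R :=
  max_kappa (fun t => `|f (hsigma h t)|)
  + max_kappa (fun t => `|left_hdiff h a alpha f t|)
  + max_kappa (fun t => `|right_hdiff h b beta f t|).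

Definition local_minimum L (A B : R) (yhat : R -> R) : Prop :=
  [/\ yhat a = A, yhat b = B &
    exists delta : R, 0 < delta /\
      forall y, y a = A -> y b = B ->
        var_norm (fun t => y t - yhat t) < delta ->
        functional L yhat <= functional L y].

End VariationalProblem.

(* Main.v *)
Require Import Defs.
From mathcomp Require Import all_boot all_order all_algebra.
From mathcomp Require Import all_classical all_reals all_analysis.
From mathcomp Require Import ring zify.
Import Order.TTheory GRing.Theory Num.Theory.
Import numFieldNormedType.Exports.
Local Open Scope classical_set_scope.
Local Open Scope ring_scope.

(** On the grid x_i = a + i h the problem is finite dimensional.  Both kinds of
    fractional h-sum are convolutions of the values f x_j with one and the same
    kernel, which depends only on the distance of i and j: the left sum uses
    the j <= i, the right sum the j >= i.  Taking forward differences, there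
    is a single matrix e (lemmas [left_hdiff_grid] and [right_hdiff_grid]) with

      left difference at x_i  = \sum_j e (i + 1) j * f x_j,
      right difference at x_i = \sum_j e j i * f x_j,

    and e is constant along diagonals: e (i + 1) (j + 1) = e i j.  Hence
    the left difference and the right one are transposes of each other up to a
    shift by one step: this is fractional summation by parts.

    Perturb yhat at the one interior point x_(m+1) by a small multiple of the
    indicator of that point ([pulse]).  The three arguments of L at x_i then
    move along a line, with velocities (i == m), e_alpha i m and
    e_beta (m + 1) i.  The functional, a finite sum, is differentiable along
    this perturbation and minimal at 0, so that its derivative vanishes
    ([euler_lagrange_sum]).  Read as a sum over i, the L_v terms are the right
    difference of L_v[yhat] at x_m, based at x_n = rho(b), and the L_w terms
    are the left difference of L_w[yhat] at x_m: this is the equation to prove.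

    The chain rule needs some care, because the mixed derivatives are given in
    one order only, and nothing is said of the u-derivatives of L_v and L_w.
    The increment of L is split by moving u first, then v, then w.  The first
    part needs L_u continuous in all three variables, the second needs L_v
    continuous in (v, w) for u fixed, and the third needs only that L_w
    exists; the hypotheses on second derivatives provide this
    ([is_derive_line_C2]). *)

(** * Partial derivatives and the chain rule along a line *)

Lemma is_derive_linear_approx (R : realType) (f : R -> R) (x d : R) :
  (forall e, 0 < e ->
     \forall t \near x, `|f t - f x - (t - x) * d| <= e * `|t - x|) ->
  is_derive x 1 f d.
Proof.
move=> fxd.
suff H : h^-1 *: ((f \o shift x) (h *: (1 : R)) - f x) @[h --> 0^'] --> d.
  by apply: DeriveDef; [apply/cvg_ex; exists d | apply: cvg_lim].
apply/cvgrPdist_le => e e0.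
have [r /= r0 xr] := fxd _ e0.
apply/nbhs_ballP; exists r => // h /= hr hn0.
have H : `|f (h + x) - f x - h * d| <= e * `|h|.
  have := xr (h + x); rewrite /ball /= addrK; apply.
  by rewrite opprD addrCA subrr addr0 -sub0r.
rewrite /= [h%:A]mulr1 distrC -(ler_pM2l (x := `|h|)) ?normr_gt0 //.
by rewrite -normrM mulrBr /GRing.scale /= mulVKf // [leRHS]mulrC.
Qed.

Lemma cvg_pair_at (S U V : topologicalType) (f : S -> U) (g : S -> V) (x : S) :
  f @ x --> f x -> g @ x --> g x -> (f s, g s) @[s --> x] --> (f x, g x).
Proof.
by move=> cf cg; exact: (@cvg_pair _ _ _ _ (nbhs (f x)) (nbhs (g x))).
Qed.

Section PartialDerivatives.
Context {R : realType} {T : topologicalType}.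
Implicit Types (F : R -> T -> R).

(** The second variable lives in an arbitrary topological space, so that it can
    stand for all the remaining variables of a function, or for some of
    them. *)
Definition D1 F : R -> T -> R := fun x p => derive1 (F^~ p) x.

Lemma mvt_first F (x0 x : R) (p : T) :
  (forall y, derivable (F^~ p) y 1) ->
  exists2 c, `|c - x0| <= `|x - x0| & F x p - F x0 p = (x - x0) * D1 F c p.
Proof.
move=> dF.
have main (a b : R) : a <= b ->
    exists2 c, a <= c <= b & F b p - F a p = (b - a) * D1 F c p.
  move=> ab.
  have [||c cab E] := @MVT_segment R (F^~ p) (D1 F ^~ p) a b ab.
  - by move=> y _; apply: DeriveDef => //; rewrite /D1 derive1E.
  - by apply: derivable_within_continuous => y _; exact: dF.
  by exists c; rewrite // mulrC.
have [le_x0x|/ltW le_xx0] := leP x0 x.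
  have [c /andP[c1 c2] E] := main _ _ le_x0x; exists c => //.
  by rewrite !ger0_norm ?subr_ge0 // lerB.
have [c /andP[c1 c2] E] := main _ _ le_xx0; exists c.
  by rewrite !ler0_norm ?subr_le0 // lerN2 lerB.
by rewrite -[RHS]opprK -mulNr opprB -E opprB.
Qed.

(** By the mean value theorem the increment is (x - x0) times a value of D1 at
    a point as close to (x0, p0) as (x, p) is.  The estimate is therefore
    uniform in the parameter p, and so p may move together with x. *)
Lemma D1_uniform_increment F (x0 : R) (p0 : T) (e : R) :
  (forall x p, derivable (F^~ p) x 1) ->
  {for (x0, p0), continuous (fun z : R * T => D1 F z.1 z.2)} -> 0 < e ->
  \forall z \near (x0, p0),
    `|F z.1 z.2 - F x0 z.2 - (z.1 - x0) * D1 F x0 p0| <= e * `|z.1 - x0|.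
Proof.
move=> dF cF e0.
have /cvgrPdist_le/(_ _ e0)[[A B] /= [A0 B0] AB] := cF.
have [r /= r0 rA] := A0.
exists (ball x0 r, B) => /=; first by split => //; exact: nbhsx_ballx.
move=> [x p] /= [xr Bp].
have [c cx ->] := mvt_first F x0 x p (dF ^~ p).
rewrite -mulrBr normrM mulrC ler_wpM2r // distrC.
apply: (AB (c, p)); split => //=; apply: rA.
by rewrite /= distrC (le_lt_trans cx) // distrC.
Qed.

(** One of the steps by which continuity of a function follows from that of its
    partial derivatives, one variable at a time. *)
Lemma continuous_first F (x0 : R) (p0 : T) :
  (forall x p, derivable (F^~ p) x 1) ->
  {for (x0, p0), continuous (fun z : R * T => D1 F z.1 z.2)} ->
  {for p0, continuous (F x0)} ->
  {for (x0, p0), continuous (fun z : R * T => F z.1 z.2)}.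
Proof.
move=> dF cD cF.
have x1 : z.1 - x0 @[z --> (x0, p0)] --> (0 : R).
  rewrite -[X in _ --> X](subrr x0).
  by apply: cvgB; [exact: cvg_fst | exact: cvg_cst].
have x2 : F x0 z.2 @[z --> (x0, p0)] --> F x0 p0.
  by apply: (cvg_comp snd (F x0)); [exact: cvg_snd | exact: cF].
have x3 : F z.1 z.2 - F x0 z.2 - (z.1 - x0) * D1 F x0 p0
    @[z --> (x0, p0)] --> (0 : R).
  apply/cvgrPdist_le => e e0.
  have u := D1_uniform_increment F x0 p0 1 dF cD ltr01.
  have v := @cvgr_dist_le _ _ _ _ _ _ _ x1 e e0.
  near=> z; rewrite sub0r normrN; apply: (@le_trans _ _ (1 * `|z.1 - x0|)).
    by near: z.
  by rewrite mul1r -[leLHS]normrN -[X in `|X|]sub0r; near: z; exact: v.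
suff H : F z.1 z.2 @[z --> (x0, p0)] --> F x0 p0 by exact: H.
have -> : (fun z : R * T => F z.1 z.2) =
  (fun z => F z.1 z.2 - F x0 z.2 - (z.1 - x0) * D1 F x0 p0
            + (z.1 - x0) * D1 F x0 p0 + F x0 z.2).
  by apply/funext => z; ring.
rewrite -[X in _ --> X](add0r (F x0 p0)).
apply: cvgD => //.
rewrite -[X in _ --> X](addr0 0); apply: cvgD => //.
rewrite -[X in _ --> X](mul0r (D1 F x0 p0)).
by apply: cvgM => //; exact: cvg_cst.
Unshelve. all: end_near.
Qed.

(** One step of the chain rule: the first variable moves along a line, and the
    others already follow their path c in both terms.  The path has only to be
    continuous, because [D1_uniform_increment] is uniform in it. *)
Lemma is_derive_first F (u p : R) (c : R -> T) (e0 : R) :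
  (forall x p, derivable (F^~ p) x 1) ->
  {for (u + e0 * p, c e0), continuous (fun z : R * T => D1 F z.1 z.2)} ->
  {for e0, continuous c} ->
  is_derive e0 1 (fun e => F (u + e * p) (c e) - F (u + e0 * p) (c e))
    (p * D1 F (u + e0 * p) (c e0)).
Proof.
move=> dF cD cc; apply: is_derive_linear_approx => e epos.
have e'0 : 0 < e / (`|p| + 1) by rewrite divr_gt0 // ltr_wpDl.
have cx : (u + e * p, c e) @[e --> e0] --> (u + e0 * p, c e0).
  apply: (@cvg_pair_at R R T (fun e => u + e * p) c);  last exact: cc.
  apply: cvgD; first exact: cvg_cst.
  by apply: cvgM; [exact: cvg_id | exact: cvg_cst].
have near_e0 : \forall t \near e0,
    `|F (u + t * p) (c t) - F (u + e0 * p) (c t)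
      - (u + t * p - (u + e0 * p)) * D1 F (u + e0 * p) (c e0)|
    <= e / (`|p| + 1) * `|u + t * p - (u + e0 * p)|.
  exact: cx _ (D1_uniform_increment _ _ _ _ dF cD e'0).
apply: filterS near_e0 => t.
rewrite opprD addrACA subrr add0r -mulrBl => H.
rewrite subrr subr0 [X in _ - X]mulrA; apply: (le_trans H).
rewrite normrM mulrCA mulrC ler_wpM2r //.
by rewrite mulrAC ler_pdivrMr ?ltr_wpDl // ler_pM2l // lerDl.
Qed.

End PartialDerivatives.

(** The chain rule for L along a line.  As the hypotheses give no L_vu, L_wu
    or L_wv, continuity of L_v and L_w in all variables is not immediate;
    moving u first, then v, then w, avoids it. *)
Lemma is_derive_line_C2 (R : realType) (L : R -> R -> R -> R -> R)
    (t u v w p q r e0 : R) :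
  C2_uvw L t ->
  let x e := u + e * p in let y e := v + e * q in let z e := w + e * r in
  is_derive e0 1 (fun e => L t (x e) (y e) (z e))
    (p * Du L t (x e0) (y e0) (z e0) + q * Dv L t (x e0) (y e0) (z e0)
     + r * Dw L t (x e0) (y e0) (z e0)).
Proof.
move=> [[dLu dLv dLw]].
move=> [[[duu cuu] [dvu cvu] [dwu cwu]] [[dwv cwv] [dvv cvv] _]] x y z.
have caff (a b : R) : {for e0, continuous (fun e : R => a + e * b)}.
  apply: cvgD; first exact: cvg_cst.
  by apply: cvgM; [exact: cvg_id | exact: cvg_cst].
have derc (f : R -> R) s : derivable f s 1 -> {for s, continuous f}.
  by move=> /derivable1_diffP/differentiable_continuous.
pose Fu (s : R) (k : R * R) := L t s k.1 k.2.
pose Fv (s k : R) := L t (x e0) s k.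
have cont_uvw G : continuous_uvw G t ->
    forall s (k : R * R), {for (s, k),
      continuous (fun m : R * (R * R) => G t m.1 m.2.1 m.2.2)}.
  move=> cG s [k1 k2].
  apply: (@continuous_comp _ _ _
    (fun m : R * (R * R) => (m.1, m.2.1, m.2.2))
    (fun m => G t m.1.1 m.1.2 m.2)); last exact: cG.
  apply: cvg_pair_at; [apply: cvg_pair_at|].
  - exact: cvg_fst.
  - by apply: (cvg_comp snd fst); [exact: cvg_snd | exact: cvg_fst].
  - by apply: (cvg_comp snd snd); [exact: cvg_snd | exact: cvg_snd].
have cont_vw G s : continuous_uvw G t ->
    forall k : R * R, {for k, continuous (fun m : R * R => G t s m.1 m.2)}.
  move=> cG k.
  apply: (@continuous_comp _ _ _ (fun m : R * R => (s, m))
    (fun m : R * (R * R) => G t m.1 m.2.1 m.2.2)); last exact: cont_uvw.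
  by apply: cvg_pair_at; [exact: cvg_cst | exact: cvg_id].
have cDu (s : R) (k : R * R) :
    {for (s, k), continuous (fun m : R * (R * R) => D1 Fu m.1 m.2)}.
  apply: (@continuous_first _ _ (fun s (k : R * R) => Du L t s k.1 k.2)).
  - by move=> *; exact: duu.
  - exact: cont_uvw cuu _ _.
  case: k => k1 k2.
  apply: (@continuous_first _ _ (fun k1 k2 => Du L t s k1 k2)).
  - by move=> *; exact: dvu.
  - exact: cont_vw cvu _.
  by apply: derc; exact: dwu.
have cDv (k : R * R) : {for k, continuous (fun m : R * R => D1 Fv m.1 m.2)}.
  case: k => k1 k2.
  apply: (@continuous_first _ _ (fun k1 k2 => Dv L t (x e0) k1 k2)).
  - by move=> *; exact: dvv.
  - exact: cont_vw cvv _.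
  by apply: derc; exact: dwv.
have E : (fun e => L t (x e) (y e) (z e)) =
   (fun e => Fu (u + e * p) (y e, z e) - Fu (u + e0 * p) (y e, z e)) \+
   ((fun e => Fv (v + e * q) (z e) - Fv (v + e0 * q) (z e)) \+
    (fun e => L t (x e0) (y e0) (z e))).
  apply/funext => e.
  by rewrite /Fu /Fv /= -/(x e) -/(x e0) -/(y e) -/(y e0); ring.
rewrite E -addrA; apply: is_deriveD; last apply: is_deriveD.
- apply: is_derive_first => //; first by move=> *; exact: dLu.
  by apply: cvg_pair_at; exact: caff.
- apply: is_derive_first; [by move=> *; exact: dLv| exact: cDv | exact: caff].
have dz : is_derive e0 1 z r.
  apply: is_derive_linear_approx => e epos; near=> s.
  by rewrite /z opprD addrACA subrr add0r -mulrBl subrr normr0 mulr_ge0 // ltW.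
rewrite [r * _]mulrC; apply: (@is_derive1_comp _ (L t (x e0) (y e0)) z) => //.
by apply: DeriveDef; [exact: dLw | rewrite /Dw derive1E].
Unshelve. all: end_near.
Qed.

(** * Fractional sums and differences on the grid *)

Section Grid.
Context {R : realType}.
Implicit Types (h alpha nu : R) (f g : R -> R) (p : int) (i j k m M : nat).

Definition grid h p i : R := (p + i%:Z)%:~R * h.

Lemma gridS h p i : grid h p i.+1 = grid h p i + h.
Proof. by rewrite /grid -addn1 PoszD addrA [in LHS]intrD mulrDl mul1r. Qed.

Lemma grid_div h p i : 0 < h -> grid h p i / h = (p + i%:Z)%:~R.
Proof. by move=> h0; rewrite /grid mulfK // gt_eqF. Qed.

Lemma gridB h p i j : (j <= i)%N ->
  grid h p i - grid h p j = (i - j)%:R * h.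
Proof.
move=> ji; rewrite /grid -mulrBl -intrB opprD addrACA subrr add0r.
by rewrite subzn // pmulrn.
Qed.

Lemma le_grid h p i j : 0 < h -> (grid h p i <= grid h p j) = (i <= j)%N.
Proof. by move=> h0; rewrite /grid ler_pM2r // ler_int lerD2l. Qed.

Lemma grid_eq h p i j : 0 < h -> (grid h p i == grid h p j) = (i == j).
Proof. by move=> h0; rewrite eq_le !le_grid // eqn_leq. Qed.

Lemma hinterval_grid h p (y t : R) : 0 < h ->
  hinterval h (grid h p 0) y t <-> exists2 i, t = grid h p i & grid h p i <= y.
Proof.
move=> h0; split.
  move=> [/andP[le_at le_ty] [k tE]].
  move: le_at; rewrite tE /grid ler_pM2r // ler_int addr0 => pk.
  have kE : k = p + `|k - p|%N%:Z.
    by rewrite gez0_abs ?subr_ge0 // addrCA subrr addr0.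
  by exists `|k - p|%N; rewrite /grid -kE // -tE.
move=> [i -> iy]; split; first by rewrite /= le_grid.
by exists (p + i%:Z).
Qed.

(** The bound M is a free parameter: sums over various integer intervals become
    sums over one and the same ordinal type, where they can be compared
    termwise. *)
Lemma zsum_grid p i k M (F : int -> R) : (k < M)%N ->
  zsum (p + i%:Z)%:~R (p + k%:Z)%:~R F =
  \sum_(j < M | (i <= j <= k)%N) F (p + j%:Z).
Proof.
move=> kM; rewrite /zsum.
pose r : seq int := [seq p + j%:Z | j <- iota 0 M & (i <= j <= k)%N].
have -> : [set n : int | (p + i%:Z)%:~R <= (n%:~R : R) <= (p + k%:Z)%:~R]
          = [set` r].
  apply/seteqP; split => n /=.
    rewrite !ler_int => /andP[lo hi].
    apply/mapP; exists `|n - p|%N; last by lia.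
    by rewrite mem_filter mem_iota; lia.
  move=> /mapP[j]; rewrite mem_filter => /andP[/andP[lo hi] _] ->.
  by rewrite !ler_int !lerD2l !lez_nat lo.
rewrite -fsbig_seq; last first.
  by rewrite map_inj_uniq ?filter_uniq ?iota_uniq // => u v; lia.
by rewrite big_map big_filter -{1}[M]subn0 -/(index_iota 0 M) big_mkord.
Qed.

Lemma hintegral_grid h p n f : 0 < h ->
  hintegral h (grid h p 0) (grid h p n.+1) f =
  \sum_(i < n.+1) f (grid h p i) * h.
Proof.
move=> h0; rewrite /hintegral !grid_div //.
have -> : (p + n.+1%:Z)%:~R - 1 = (p + n%:Z)%:~R :> R.
  by rewrite -addn1 PoszD addrA [in LHS]intrD addrK.
rewrite (zsum_grid _ _ _ _ _ (ltnSn n)).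
by apply: eq_bigl => i; rewrite leq0n -ltnS ltn_ord.
Qed.

(** The weight that a value at distance n h has in an h-sum of order nu, left or
    right.  For nu = 0 it is the unit of convolution, in agreement with the
    convention that the sum of order 0 is the identity. *)
Definition hsum_kernel h nu (n : nat) : R :=
  if nu == 0 then (n == 0)%N%:R else
  (Gamma nu)^-1 * hfactorial h (n%:R * h + nu * h - h) (nu - 1) * h.

Lemma left_hsum_grid h p nu f i M : 0 < h -> (i < M)%N ->
  left_hsum h (grid h p 0) nu f (grid h p i) =
  \sum_(j < M) (j <= i)%N%:R * hsum_kernel h nu (i - j)%N * f (grid h p j).
Proof.
move=> h0 iM; rewrite /left_hsum /hsum_kernel; case: ifP => _.
  rewrite (bigD1 (Ordinal iM)) //= leqnn subnn eqxx !mul1r big1 ?addr0 // => j.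
  rewrite -val_eqE /= => ji; case: leqP => [le_ji|]; last by rewrite !mul0r.
  by rewrite subn_eq0 leqNgt ltn_neqAle ji le_ji mulr0 mul0r.
rewrite !grid_div // (zsum_grid _ _ _ _ _ iM) mulr_sumr big_mkcond.
apply: eq_bigr => j _ /=; case: leqP => [le_ji|]; last by rewrite !mul0r.
rewrite -(gridB h p) // /hsigma -/(grid h p j) mul1r.
have -> : grid h p i + nu * h - (grid h p j + h) =
  grid h p i - grid h p j + nu * h - h by ring.
by ring.
Qed.

Lemma right_hsum_grid h p nu f i k : 0 < h -> (i <= k)%N ->
  right_hsum h (grid h p k) nu f (grid h p i) =
  \sum_(j < k.+1) (i <= j)%N%:R * hsum_kernel h nu (j - i)%N * f (grid h p j).
Proof.
move=> h0 ik; rewrite /right_hsum /hsum_kernel; case: ifP => _.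
  have ik1 : (i < k.+1)%N by [].
  rewrite (bigD1 (Ordinal ik1)) //= leqnn subnn eqxx !mul1r big1 ?addr0 // => j.
  rewrite -val_eqE /= => ji; case: leqP => [le_ij|]; last by rewrite !mul0r.
  by rewrite subn_eq0 leqNgt ltn_neqAle eq_sym ji le_ij mulr0 mul0r.
rewrite !grid_div // (zsum_grid _ _ _ _ _ (ltnSn k)) mulr_sumr big_mkcond.
apply: eq_bigr => j _ /=; rewrite -[(j <= k)%N]ltnS ltn_ord andbT.
case: leqP => [le_ij|]; last by rewrite !mul0r.
rewrite -(gridB h p) // /hsigma -/(grid h p j) mul1r.
have -> : grid h p j + nu * h - (grid h p i + h) =
  grid h p j - grid h p i + nu * h - h by ring.
by ring.
Qed.

(** The matrix of the left fractional difference, with rows shifted by one step: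
    see [left_hdiff_grid] and [right_hdiff_grid].  The boolean factors discard
    the entries where the subtraction of naturals is truncated. *)
Definition hdiff_coef h alpha i j : R :=
  ((j <= i)%N%:R * hsum_kernel h (1 - alpha) (i - j)%N
   - (j < i)%N%:R * hsum_kernel h (1 - alpha) (i - j.+1)%N) / h.

(** The row is i + 1 because the forward difference at x_i reaches the value
    at x_(i+1). *)
Lemma left_hdiff_grid h p alpha f i M : 0 < h -> (i.+1 < M)%N ->
  left_hdiff h (grid h p 0) alpha f (grid h p i) =
  \sum_(j < M) hdiff_coef h alpha i.+1 j * f (grid h p j).
Proof.
move=> h0 iM; rewrite /left_hdiff /hdelta -gridS.
rewrite !(left_hsum_grid _ _ _ _ _ M) // 1?ltnW // -sumrB mulr_suml.
by apply: eq_bigr => j _; rewrite /hdiff_coef ltnS subSS; ring.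
Qed.

(** The transpose of the matrix of [left_hdiff_grid], without its shift: moving
    from x_i to x_(i+1) decreases the distance to the values on the right, and
    the sign in the definition of the right difference restores the order of
    the two kernel values. *)
Lemma right_hdiff_grid h p alpha f i k : 0 < h -> (i < k)%N ->
  right_hdiff h (grid h p k) alpha f (grid h p i) =
  \sum_(j < k.+1) hdiff_coef h alpha j i * f (grid h p j).
Proof.
move=> h0 ik; rewrite /right_hdiff /hdelta -gridS.
rewrite !right_hsum_grid // 1?ltnW // -mulNr opprB -sumrB mulr_suml.
by apply: eq_bigr => j _; rewrite /hdiff_coef; ring.
Qed.

Lemma hdiff_coefSS h alpha i j :
  hdiff_coef h alpha i.+1 j.+1 = hdiff_coef h alpha i j.
Proof. by rewrite /hdiff_coef !subSS !ltnS. Qed.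

Definition pulse h p m (s : R) : R := (s == grid h p m)%:R.

Lemma sum_pulse h p m M (c : nat -> R) : 0 < h -> (m < M)%N ->
  \sum_(j < M) c j * pulse h p m (grid h p j) = c m.
Proof.
move=> h0 mM; rewrite (bigD1 (Ordinal mM)) //= /pulse eqxx mulr1.
rewrite big1 ?addr0 // => j; rewrite -val_eqE /= => jm.
by rewrite grid_eq // (negbTE jm) mulr0.
Qed.

Lemma left_hdiff_pulse h p alpha f (e : R) i m M :
  0 < h -> (i.+1 < M)%N -> (m < M)%N ->
  left_hdiff h (grid h p 0) alpha (fun s => f s + e * pulse h p m s)
    (grid h p i) =
  left_hdiff h (grid h p 0) alpha f (grid h p i)
  + e * hdiff_coef h alpha i.+1 m.
Proof.
move=> h0 iM mM; rewrite !(left_hdiff_grid _ _ _ _ _ M) //.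
rewrite -[hdiff_coef _ _ _ m](sum_pulse h p m M (hdiff_coef h alpha i.+1)) //.
by rewrite mulr_sumr -big_split; apply: eq_bigr => j _; rewrite mulrDr mulrCA.
Qed.

Lemma right_hdiff_pulse h p alpha f (e : R) i m k :
  0 < h -> (i < k)%N -> (m <= k)%N ->
  right_hdiff h (grid h p k) alpha (fun s => f s + e * pulse h p m s)
    (grid h p i) =
  right_hdiff h (grid h p k) alpha f (grid h p i)
  + e * hdiff_coef h alpha m i.
Proof.
move=> h0 ik mk; rewrite !right_hdiff_grid //.
rewrite -[hdiff_coef _ _ m _](sum_pulse h p m k.+1
  (hdiff_coef h alpha ^~ i)) //.
by rewrite mulr_sumr -big_split; apply: eq_bigr => j _; rewrite mulrDr mulrCA.
Qed.

Lemma max_kappa_le h p n f (C : R) : 0 < h ->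
  (forall i, (i <= n)%N -> f (grid h p i) <= C) ->
  max_kappa h (grid h p 0) (grid h p n.+1) f <= C.
Proof.
move=> h0 fC; apply: ge_sup.
  exists (f (grid h p 0)), (grid h p 0) => //; apply/hinterval_grid => //.
  by exists 0%N => //; rewrite gridS addrK le_grid.
move=> _ [t + <-] => /(hinterval_grid _ _ _ _ h0)[i ->].
by rewrite gridS addrK le_grid // => /fC.
Qed.

End Grid.

(** * The first variation *)

Section FirstVariation.
Context {R : realType}.
Context (h : R) (p : int) (n : nat) (alpha beta : R).
Let a := grid h p 0.
Let b := grid h p n.+1.

(** All three parts of the norm are homogeneous in e, so that small multiples of
    a pulse are admissible variations. *)
Lemma var_norm_pulse (m : nat) (f : R -> R) : 0 < h -> (m <= n)%N ->
  exists2 C, 0 < C & forall e : R,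
    var_norm h a b alpha beta (fun s => f s + e * pulse h p m s - f s)
      <= `|e| * C.
Proof.
move=> h0 mn.
pose CL := \sum_(i < n.+1) `|hdiff_coef h alpha i.+1 m|.
pose CR := \sum_(i < n.+1) `|hdiff_coef h beta m i|.
have CL0 : 0 <= CL by exact: sumr_ge0.
have CR0 : 0 <= CR by exact: sumr_ge0.
exists (1 + CL + CR); first by rewrite -addrA ltr_pwDl // addr_ge0.
move=> e.
have -> : (fun s => f s + e * pulse h p m s - f s) =
    (fun s => 0 + e * pulse h p m s) by apply/funext => s; ring.
have L0 i : (i <= n)%N -> left_hdiff h a alpha (fun=> 0) (grid h p i) = 0.
  move=> le_in; rewrite (left_hdiff_grid _ _ _ _ _ n.+2) // big1 // => j _.
  by rewrite mulr0.
have R0 i : (i <= n)%N -> right_hdiff h b beta (fun=> 0) (grid h p i) = 0.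
  by move=> le_in; rewrite right_hdiff_grid // big1 // => j _; rewrite mulr0.
have term_le (c : nat -> R) i : (i <= n)%N ->
    `|c i| <= \sum_(j < n.+1) `|c j|.
  move=> le_in; have lt_in : (i < n.+1)%N by [].
  by rewrite (bigD1 (Ordinal lt_in)) //= lerDl sumr_ge0.
rewrite /var_norm !mulrDr mulr1; apply: lerD; first apply: lerD.
- apply: max_kappa_le => // i _; rewrite add0r normrM.
  by rewrite ler_piMr // /pulse; case: eqP; rewrite ?normr1 ?normr0.
- apply: max_kappa_le => // i le_in.
  rewrite (left_hdiff_pulse _ _ _ _ _ _ _ n.+2) // 1?leqW // L0 // add0r normrM.
  by rewrite ler_wpM2l // (term_le (fun i => hdiff_coef h alpha i.+1 m)).
- apply: max_kappa_le => // i le_in.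
  rewrite right_hdiff_pulse // 1?leqW // R0 // add0r normrM.
  by rewrite ler_wpM2l // (term_le (fun i => hdiff_coef h beta m i)).
Qed.

(** Fermat's rule for the perturbation of yhat at the interior point x_(m+1).
    The coefficient of L_v arises as e_alpha (i + 1) (m + 1) and equals
    e_alpha i m by [hdiff_coefSS], which is the entry that occurs in the right
    difference at x_m. *)
Lemma euler_lagrange_sum (m : nat) (L : R -> R -> R -> R -> R) (A B : R)
    (yhat : R -> R) :
  0 < h -> (m < n)%N ->
  (forall t, hinterval h a (b - h) t -> C2_uvw L t) ->
  local_minimum h a b alpha beta L A B yhat ->
  \sum_(i < n.+1)
    ((i == m :> nat)%:R * along h a b alpha beta (Du L) yhat (grid h p i)
     + hdiff_coef h alpha i m
       * along h a b alpha beta (Dv L) yhat (grid h p i)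
     + hdiff_coef h beta m.+1 i
       * along h a b alpha beta (Dw L) yhat (grid h p i)) = 0.
Proof.
move=> h0 mn hL [ya yb [delta [delta0 ymin]]].
pose y e s := yhat s + e * pulse h p m.+1 s.
have mSn : (m.+1 <= n)%N by [].
pose u i e := yhat (grid h p i.+1) + e * (i == m)%:R.
pose v i e := left_hdiff h a alpha yhat (grid h p i)
  + e * hdiff_coef h alpha i m.
pose w i e := right_hdiff h b beta yhat (grid h p i)
  + e * hdiff_coef h beta m.+1 i.
have alongE F e i : (i <= n)%N ->
    along h a b alpha beta F (y e) (grid h p i) =
    F (grid h p i) (u i e) (v i e) (w i e).
  move=> le_in; rewrite /along /hsigma -gridS /y.
  rewrite (left_hdiff_pulse _ _ _ _ _ _ _ n.+2) // 1?leqW // hdiff_coefSS.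
  by rewrite right_hdiff_pulse // 1?leqW // /pulse grid_eq.
have y0 : y 0 = yhat by apply/funext => s; rewrite /y mul0r addr0.
pose D e := \sum_(i < n.+1)
  ((i == m :> nat)%:R * along h a b alpha beta (Du L) (y e) (grid h p i)
   + hdiff_coef h alpha i m * along h a b alpha beta (Dv L) (y e) (grid h p i)
   + hdiff_coef h beta m.+1 i
     * along h a b alpha beta (Dw L) (y e) (grid h p i)).
suff : h * D 0 = 0.
  by rewrite /D y0 => /eqP; rewrite mulf_eq0 gt_eqF //= => /eqP.
pose phi e := functional h a b alpha beta L (y e).
have dphi (e : R) : is_derive e 1 phi (h * D e).
  have -> : phi = \sum_(i < n.+1)
      h \*: (fun e => L (grid h p i) (u i e) (v i e) (w i e)).
    apply/funext => s; rewrite /phi /functional hintegral_grid // fct_sumE.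
    apply: eq_bigr => i _.
    have le_in : (i <= n)%N by rewrite -ltnS.
    by rewrite (alongE L s i le_in) mulrC.
  rewrite /D mulr_sumr; apply: is_derive_sum => i.
  have le_in : (i <= n)%N by rewrite -ltnS.
  have Li : C2_uvw L (grid h p i).
    apply: hL; apply/hinterval_grid => //; exists i => //.
    by rewrite /b gridS addrK le_grid.
  have := is_derive_line_C2 _ _ _ (yhat (grid h p i.+1))
     (left_hdiff h a alpha yhat (grid h p i))
     (right_hdiff h b beta yhat (grid h p i)) (i == m :> nat)%:R
     (hdiff_coef h alpha i m) (hdiff_coef h beta m.+1 i) e Li.
  rewrite /= -/(u i) -/(v i) -/(w i) -/(u i e) -/(v i e) -/(w i e) => dLi.
  rewrite (alongE (Du L) e i le_in) (alongE (Dv L) e i le_in).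
  rewrite (alongE (Dw L) e i le_in).
  exact: (@is_deriveZ _ _ _ _ h e 1 _ dLi).
have [C C0 normC] := var_norm_pulse m.+1 yhat h0 mSn.
pose r := delta / C.
have r0 : 0 < r by rewrite divr_gt0.
have min0 e : e \in `]-r, r[ -> phi 0 <= phi e.
  rewrite in_itv /= -ltr_norml => er; rewrite /phi y0; apply: ymin.
  - by rewrite /y /pulse grid_eq // mulr0 addr0.
  - by rewrite /y /pulse grid_eq // eqSS gtn_eqF // mulr0 addr0.
  by apply: le_lt_trans (normC e) _; rewrite -ltr_pdivlMr.
have [||| _ D0] := @derive1_at_min R phi (- r) r 0 _ _ _ min0.
- by rewrite ge0_cp // ltW.
- by [].
- by rewrite in_itv /= oppr_lt0 r0.
by have [_ D0'] := dphi 0; rewrite -D0' D0.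
Qed.

End FirstVariation.

Theorem theorem151 (R : realType) (h a b alpha beta : R)
    (hpos : 0 < h) (ha : hZ h a) (hb : hZ h b) (hab : a < b)
    (halpha : 0 < alpha <= 1) (hbeta : 0 < beta <= 1)
    (L : R -> R -> R -> R -> R)
    (hL : forall t, hinterval h a (b - h) t -> C2_uvw L t)
    (A B : R) (yhat : R -> R)
    (hmin : local_minimum h a b alpha beta L A B yhat) :
  forall t, hinterval h a (b - 2 * h) t ->
    along h a b alpha beta (Du L) yhat t
    + right_hdiff h (hrho h b) alpha (along h a b alpha beta (Dv L) yhat) t
    + left_hdiff h a beta (along h a b alpha beta (Dw L) yhat) t = 0.
Proof.
case: ha => p aE.
have {}aE : a = grid h p 0 by rewrite /grid addr0.
case: hb => q bE.
have [n {}bE] : exists n : nat, b = grid h p n.+1.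
  have pq : p < q.
    by move: hab; rewrite aE bE /grid addr0 ltr_pM2r // ltr_int.
  exists `|q - p|%N.-1; rewrite bE /grid; congr (_%:~R * _); lia.
subst a b => t.
move=> /(hinterval_grid _ _ _ _ hpos)[m -> mb].
have mn : (m < n)%N.
  rewrite -ltnS -(le_grid h p m.+2) // !(gridS _ _ m.+1, gridS _ _ m).
  by rewrite -addrA -mulr2n -mulr_natl -lerBrDr.
have -> : hrho h (grid h p n.+1) = grid h p n by rewrite /hrho gridS addrK.
rewrite right_hdiff_grid // (left_hdiff_grid _ _ _ _ _ n.+1) //.
have EL := euler_lagrange_sum _ _ _ _ _ _ _ _ _ _ hpos mn hL hmin.
rewrite -[RHS]EL !big_split /=; congr (_ + _ + _).
have mSn : (m < n.+1)%N by exact: ltnW.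
rewrite (bigD1 (Ordinal mSn)) //= eqxx mul1r big1 ?addr0 // => i.
by rewrite -val_eqE => /negbTE /= ->; rewrite mul0r.
Qed.
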